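(* For every integer $k\ge 2$, $f(k)\le \frac{k(k+1)+2}{4(k-1)}$. Moreover, for every integer $k\ge 1$ such that $k+1$ is divisible by neither $3$ nor $4$, $f(k)\le\frac{k(k+1)+1}{4k}$.
   Context: Let $P\subset\mathbb{Z}^2$ be a finite set of grid points. There are four directions: horizontal $(1,0)$, vertical $(0,1)$, and the two diagonals $(1,1)$ and $(1,-1)$. For a direction $d$ and an integer $k\ge 1$, a line segment of length $k$ of $P$ in direction $d$ is a set $\{p,p+d,\dots,p+(k-1)d\}\subseteq P$ such that $p-d\notin P$ and $p+kd\notin P$ (a maximal run of exactly $k$ points). Segments are counted separately for each direction, so that an isolated point gives $4$ line segments of length $1$. For integers $k,n\ge 1$, $a_k(n)$ denotes the minimal cardinality of a finite set $P\subset\mathbb{Z}^2$ that has at least $n$ line segments of length $k$ (counted over all four directions). Define $f(k)=\lim_{n\to\infty}\frac{a_k(n)}{n}$; this limit exists for every $k\ge 1$. *)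

(* Defs.v *)
From mathcomp Require Import all_boot all_order all_algebra finmap.
From mathcomp Require Import zify.
From mathcomp Require Import all_classical all_reals all_analysis.
Set Implicit Arguments.
Unset Strict Implicit.
Unset Printing Implicit Defensive.
Import Order.TTheory GRing.Theory Num.Theory.
Import numFieldNormedType.Exports.
Local Open Scope fset_scope.
Local Open Scope classical_set_scope.
Local Open Scope ring_scope.

Definition directions : seq (int * int) :=
  [:: (1, 0); (0, 1); (1, 1); (1, -1)].

Definition run (p d : int * int) (k : nat) : {fset int * int} :=
  [fset (p + d *+ i : int * int) | i in iota 0 k].

Definition segments (P : {fset int * int}) (d : int * int) (k : nat) :
    {fset {fset int * int}} :=
  [fset run p d k | p in P &
    [&& (run p d k `<=` P)%fset, p - d \notin P & p + d *+ k \notin P]].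

(* The sum keeps directions apart: a one-point run is counted once for each
   direction in which it is maximal. *)
Definition num_segments (P : {fset int * int}) (k : nat) : nat :=
  (\sum_(d <- directions) #|` segments P d k|)%N.

Definition min_points_spec (k n m : nat) : Prop :=
  (exists P : {fset int * int}, #|` P| = m /\ (n <= num_segments P k)%N) /\
  (forall P : {fset int * int}, (n <= num_segments P k)%N -> (m <= #|` P|)%N).

(* The default value 0 is only used when [k = 0]; see [min_pointsP]. *)
Definition min_points (k n : nat) : nat :=
  xget 0%N [set m | min_points_spec k n m].

Lemma mulrn01 (i : nat) : ((0, 1) : int * int) *+ i = (0, i%:Z).
Proof. by elim: i => // i IH; rewrite mulrSr IH; congr (_, _); rewrite /=; lia. Qed.

Lemma run0P (x : int) (k : nat) (q : int * int) :
  reflect (exists2 i, (i < k)%N & q = (x, i%:Z)) (q \in run (x, 0) (0, 1) k).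
Proof.
have E i : (x, 0) + (0, 1) *+ i = (x, i%:Z) :> (int * int).
  by rewrite mulrn01; congr (_, _); rewrite /=; lia.
apply: (iffP (imfsetP _ _ _ _)) => [[i] /=|[i ik ->]].
  by rewrite mem_iota => /= ik ->; exists i; rewrite ?E.
by exists i; rewrite ?E //= mem_iota.
Qed.

(* [n] parallel vertical bars of [k] points, in every other column. *)
Lemma bars_exist (k n : nat) : (0 < k)%N ->
  exists P : {fset int * int}, (n <= num_segments P k)%N.
Proof.
move=> k0.
pose P : {fset int * int} := seq_fset tt
  [seq ((2 * i)%N%:Z, j%:Z) : int * int | i <- iota 0 n, j <- iota 0 k].
have inP q : reflect (exists i j, [/\ (i < n)%N, (j < k)%N &
    q = ((2 * i)%N%:Z, j%:Z)]) (q \in P).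
  rewrite seq_fsetE; apply: (iffP allpairsP) => [[[i j]] /=|[i [j [hi hj ->]]]].
    by rewrite !mem_iota /= => -[hi hj ->]; exists i, j.
  by exists (i, j); rewrite !mem_iota.
exists P; rewrite /num_segments /directions big_cons big_cons.
apply: (leq_trans _ (leq_addl _ _)); apply: (leq_trans _ (leq_addr _ _)).
pose F (i : nat) := run ((2 * i)%N%:Z, 0) (0, 1) k.
have -> : n = #|` [fset F i | i in iota 0 n]%fset|.
  rewrite card_in_imfset /=.
    by rewrite undup_id ?iota_uniq // size_iota.
  move=> i j _ _ FE.
  have : ((2 * i)%N%:Z, 0%:Z) \in F j by rewrite -FE; apply/run0P; exists 0%N.
  by case/run0P => l _ []; lia.
apply: fsubset_leq_card; apply/fsubsetP => _ /imfsetP[i /= + ->].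
rewrite mem_iota => /= hi; apply/imfsetP; exists ((2 * i)%N%:Z, 0) => //=.
rewrite !inE; apply/andP; split; first by apply/inP; exists i, 0%N.
apply/and3P; split.
- by apply/fsubsetP => q /run0P[j hj ->]; apply/inP; exists i, j.
- by apply/inP => -[i' [j [_ _ []]]]; lia.
- apply/inP => -[i' [j [_ hj]]].
  by rewrite mulrn01; case; lia.
Qed.

Lemma min_pointsP (k n : nat) : (0 < k)%N -> min_points_spec k n (min_points k n).
Proof.
move=> /(bars_exist n) [P0 hP0].
have ex : exists m, `[< exists P : {fset int * int},
    #|` P| = m /\ (n <= num_segments P k)%N >].
  by exists #|` P0|; apply/asboolP; exists P0.
rewrite /min_points; case: xgetP => [m _ //|]; case: (ex_minnP ex) => m /asboolP hm hmin.
move=> /(_ m); case; split=> // P hP; apply: hmin; apply/asboolP; by exists P.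
Qed.

(* [lim] has a default value on divergent sequences; for [k > 0] this sequence
   converges by Fekete's lemma, [min_points k] being subadditive. *)
Definition f (R : realType) (k : nat) : R :=
  lim ((fun n : nat => (min_points k n)%:R / n%:R : R) @ \oo).

(* Main.v *)
Require Import Defs.
From mathcomp Require Import all_boot all_order all_algebra finmap.
From mathcomp Require Import zify ring lra.
From mathcomp Require Import all_classical all_reals all_analysis.
Set Implicit Arguments.
Unset Strict Implicit.
Unset Printing Implicit Defensive.
Import Order.TTheory GRing.Theory Num.Theory.
Import numFieldNormedType.Exports.
Local Open Scope classical_set_scope.
Local Open Scope ring_scope.

(** Put [M = k + 1], place [q] pairwise non-attacking queens on the [M x M]
torus, and remove from the plane all the points whose residues modulo [M] are
those of a queen.  A removed point [h] and [h + M d] are consecutive removed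
points of their line, for each of the four directions [d], so that every
removed point accounts for four segments of length [k]: in a large window there
are about [M^2 - q] points for [4 q] segments.  The bounds thus follow from
Monsky's theorem: there is room for [M - 2] queens if [M > 2], and for [M - 1]
queens if neither 3 nor 4 divides [M].

To place the queens, write [M = a r + b] for one of finitely many pairs
[(a, b)].  The queens form a bounded number of arithmetic progressions of slope
2 whose end points are affine functions of [r], so that one finite computation
shows that they do not attack each other, for all large [r] simultaneously. *)

(** * Queens in progressions of slope 2, and a finite test valid for all large [r] *)

(* Row, column and the two diagonals of a point. *)
Definition forms : seq (int * int) := [:: (1, 0); (0, 1); (1, 1); (-1, 1)].

Definition attacks (M : int) (p q : int * int) : bool :=
  has (fun f => M %| f.1 * (p.1 - q.1) + f.2 * (p.2 - q.2))%Z forms.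

Definition peaceful (M : int) : seq (int * int) -> bool :=
  pairwise (fun p q => ~~ attacks M p q).

Definition affine : Type := (int * int)%type.

Definition aval (r : int) (a : affine) : int := a.1 * r + a.2.

Definition ascale (z : int) (a : affine) : affine := (z * a.1, z * a.2).

Lemma avalD (r : int) (a b : affine) : aval r (a + b) = aval r a + aval r b.
Proof. by rewrite /aval /= mulrDl addrACA. Qed.

Lemma avalB (r : int) (a b : affine) : aval r (a - b) = aval r a - aval r b.
Proof. by rewrite /aval /= mulrBl opprD addrACA. Qed.

Lemma avalZ (r z : int) (a : affine) : aval r (ascale z a) = z * aval r a.
Proof. by rewrite /aval /= mulrDr mulrA. Qed.

Lemma aval1 (r : int) : aval r (0, 1) = 1.
Proof. by rewrite /aval mul0r add0r. Qed.

(** A decidable condition that forces positivity at every [r >= r0]. *)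
Definition apos (r0 : int) (a : affine) : bool := (0 <= a.1) && (0 < aval r0 a).

Lemma aposP (r0 r : int) (a : affine) : r0 <= r -> apos r0 a -> 0 < aval r a.
Proof.
move=> le_r /andP[a1_ge0 /lt_le_trans]; apply.
by rewrite lerD2r ler_wpM2l.
Qed.

(* Row and column of the first queen, number of queens. *)
Definition piece : Type := (affine * affine * affine)%type.

(** From one queen to the next, the four [forms] grow by 1, 2, 3 and 1 times [step]. All these
    increments are positive, and with [step] 1 or 2 their only prime factors are 2 and 3. *)
Definition queen (step r : int) (p : piece) (i : nat) : int * int :=
  (aval r p.1.1 + step * i%:Z, aval r p.1.2 + 2 * step * i%:Z).

Definition plen (r : int) (p : piece) : nat := `|aval r p.2|%N.

Definition queens (step r : int) (p : piece) : seq (int * int) :=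
  mkseq (queen step r p) (plen r p).

Definition board (step r : int) (t : seq piece) : seq (int * int) :=
  flatten [seq queens step r p | p <- t].

(* A criterion, uniform in [r >= r0], for [z * M] to differ from all the values
   [D + g * d] between [lo] and [hi]: it is out of range, or it differs from [D]
   modulo a divisor of [g]. *)
Definition misses (r0 g : int) (D lo hi M : affine) (z : int) : bool :=
  let zM := ascale z M in
  [|| apos r0 (zM - hi), apos r0 (lo - zM)
    | has (fun h : int => [&& h %| g, h %| (zM - D).1 & ~~ (h %| (zM - D).2)])%Z
          [:: 2; 3; 4]].

Lemma missesP (r0 r g z d : int) (D lo hi M : affine) :
  r0 <= r -> misses r0 g D lo hi M z ->
  aval r lo <= aval r D + g * d <= aval r hi ->
  aval r D + g * d != z * aval r M.
Proof.
move=> le_r /or3P[/(aposP le_r)|/(aposP le_r)|/hasP[h _ /and3P[hg h1 h2]]].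
- by rewrite avalB avalZ; lia.
- by rewrite avalB avalZ; lia.
move=> _; apply: contra h2 => /eqP E.
have : (h %| aval r (ascale z M - D))%Z.
  by rewrite avalB avalZ -E addrAC subrr add0r dvdz_mulr.
(* Since [h] divides the coefficient of [r], it would have to divide the constant term too. *)
by rewrite /aval rpredDl // dvdz_mulr.
Qed.

(* The two conditions at [5] and [-5] leave only [z] between [-4] and [4] to be
   tested.  If [p] and [q] are the [same] piece, then [z = 0] is harmless, since
   it forces the two queens to coincide. *)
Definition separated (r0 step : int) (M : affine) (p q : piece) (same : bool) :
    bool :=
  all (fun f : int * int =>
    let g := (f.1 + 2 * f.2) * step in
    let D := ascale f.1 (p.1.1 - q.1.1) + ascale f.2 (p.1.2 - q.1.2) in
    let hi := D + ascale g (p.2 - (0, 1)) in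
    let lo := D - ascale g (q.2 - (0, 1)) in
    [&& 0 < g, apos r0 (ascale 5 M - hi), apos r0 (lo + ascale 5 M) &
      all (fun z => same && (z == 0) || misses r0 g D lo hi M z)
        [:: -4; -3; -2; -1; 0; 1; 2; 3; 4]]) forms.

Lemma separatedP (r0 r step : int) (M : affine) (p q : piece) (same : bool)
    (i j : nat) :
  r0 <= r -> apos r0 M -> i%:Z < aval r p.2 -> j%:Z < aval r q.2 ->
  separated r0 step M p q same -> (same -> p = q /\ i != j) ->
  ~~ attacks (aval r M) (queen step r p i) (queen step r q j).
Proof.
move=> le_r /(aposP le_r) M0 ip jq /allP sep sameP.
apply/hasPn => f /sep; cbv zeta beta.
set g := _ * step; set D := _ + ascale f.2 _.
set hi := D + _; set lo := D - _.
case/and4P => g0 /(aposP le_r) hi5 /(aposP le_r) lo5 /allP zP.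
rewrite avalB avalZ in hi5; rewrite avalD avalZ in lo5.
apply/negP => /dvdzP[c].
have -> : f.1 * (aval r p.1.1 + step * i - (aval r q.1.1 + step * j)) +
    f.2 * (aval r p.1.2 + 2 * step * i - (aval r q.1.2 + 2 * step * j)) =
    aval r D + g * (i%:Z - j%:Z).
  by rewrite avalD !avalZ !avalB /g; ring.
(* The index difference [i - j] runs from [1 - aval r q.2] to [aval r p.2 - 1], and [g] is
   positive. *)
have bnd : aval r lo <= aval r D + g * (i%:Z - j%:Z) <= aval r hi.
  rewrite [aval r hi]avalD avalB !avalZ !avalB aval1 !lerD2l -mulrN.
  rewrite !ler_pM2l //.
  by clear -ip jq; lia.
move=> E.
have c5 : c < 5 by rewrite -(ltr_pM2r M0); lia.
have c5' : - 5 < c by rewrite -(ltr_pM2r M0); lia.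
have /zP /orP[/andP[/sameP[pq ij] /eqP c0]|/missesP -/(_ r _ le_r bnd)] :
    c \in [:: -4; -3; -2; -1; 0; 1; 2; 3; 4] by rewrite !inE; lia.
  have D0 : aval r D = 0 by rewrite avalD !avalZ !avalB pq; ring.
  move/eqP: E; rewrite D0 add0r c0 mul0r mulf_eq0 gt_eqF //= subr_eq0 eqz_nat.
  exact/negP.
by rewrite E eqxx.
Qed.

(** Adding [(0, 1)] turns positivity into nonnegativity: a piece may be empty, but its length is
    never negative, so the absolute value in [plen] is harmless. *)
Definition valid (r0 step : int) (M : affine) (t : seq piece) : bool :=
  [&& apos r0 M, pairwise (fun p q => separated r0 step M p q false) t
    & all (fun p => separated r0 step M p p true && apos r0 (p.2 + (0, 1))) t].

Lemma board_peaceful (r0 r step : int) (M : affine) (t : seq piece) :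
  r0 <= r -> valid r0 step M t -> peaceful (aval r M) (board step r t).
Proof.
move=> le_r /and3P[M0 sep1 /allP sep2].
have lenP p i : p \in t -> (i < plen r p)%N -> i%:Z < aval r p.2.
  move=> /sep2 /andP[_ /(aposP le_r)]; rewrite avalD aval1 ltzD1 => p0.
  by rewrite -ltz_nat gez0_abs.
have {}sep2 p : p \in t -> separated r0 step M p p true.
  by move=> /sep2 /andP[].
elim: t sep1 sep2 lenP => [|p t IH] //.
rewrite pairwise_cons => /andP[/allP sep1 sep1'] sep2 lenP.
rewrite /peaceful /board /= pairwise_cat; apply/and3P; split.
- apply/allrelP => _ _ /mapP[i + ->] /flattenP[_ /mapP[q qt ->] /mapP[j + ->]].
  rewrite !mem_iota => /= hi hj.
  by apply: (separatedP le_r M0 _ _ (sep1 _ qt)) => //; apply: lenP => //;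
    rewrite inE ?eqxx ?qt ?orbT.
- rewrite pairwise_map.
  apply: (@sub_in_pairwise _ (mem (iota 0 (plen r p))) [rel i j | i != j]).
  + move=> i j; rewrite !mem_iota => /= hi hj ij.
    by apply: (separatedP le_r M0 _ _ (sep2 _ _)) => //; rewrite ?mem_head //;
      apply: lenP => //; rewrite mem_head.
  + by apply/allP.
  + by rewrite -uniq_pairwise iota_uniq.
- apply: IH => // [q qt|q i qt]; last by apply: lenP; rewrite inE qt orbT.
  by apply: sep2; rewrite inE qt orbT.
Qed.

Lemma size_board (r0 r step : int) (M : affine) (t : seq piece) :
  r0 <= r -> valid r0 step M t ->
  (size (board step r t))%:Z = aval r (foldr (fun p => +%R p.2) 0 t).
Proof.
move=> le_r /and3P[_ _]; elim: t => [|p t IH] /=.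
  by rewrite /aval mul0r.
case/andP=> /andP[_ /(aposP le_r)]; rewrite avalD aval1 ltzD1 => p0 /IH E.
by rewrite /board /= size_cat avalD PoszD -E size_mkseq gez0_abs.
Qed.

(** Coordinates are arbitrary integers, read modulo [M]. The number [q] is an integer so that
    [M - 1] and [M - 2] are not truncated. *)
Definition has_queens (M q : int) : Prop :=
  exists2 s, peaceful M s & (size s)%:Z = q.

(** Shaped for the tables: [valid] is settled by evaluation, the two affine identities by [ring]. *)
Lemma board_queens (r0 r step m q : int) (M : affine) (t : seq piece) :
  r0 <= r -> valid r0 step M t ->
  aval r M = m -> aval r (foldr (fun p => +%R p.2) 0 t) = q ->
  has_queens m q.
Proof.
move=> le_r tP <- <-; exists (board step r t); first exact: board_peaceful tP.
exact: size_board tP.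
Qed.

(** * Placements in parametric families *)

(* The following tables were found by a computer search. *)
Lemma queens_6r1 (r : int) : 0 <= r ->
  has_queens (6 * r + 1) (6 * r + 1).
Proof.
(* A single progression winds around the whole torus: the increments 1, 2, 3 and 1 are prime to
   [M]. *)
move=> /board_queens; apply=> /=; first exact: (isT : valid 0 1 (6, 1) [::
    ((0, 0), (0, 0), (6, 1))]).
all: by rewrite /aval /=; ring.
Qed.

Lemma queens_6r5 (r : int) : 0 <= r ->
  has_queens (6 * r + 5) (6 * r + 5).
Proof.
move=> /board_queens; apply=> /=; first exact: (isT : valid 0 1 (6, 5) [::
    ((0, 0), (0, 0), (6, 5))]).
all: by rewrite /aval /=; ring.
Qed.

Lemma queens_12r2 (r : int) : 1 <= r ->
  has_queens (12 * r + 2) (12 * r + 2 - 1).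
Proof.
move=> /board_queens; apply=> /=; first exact: (isT : valid 1 2 (12, 2) [::
    ((0, 0), (0, 0), (3, -1)); ((0, 1), (6, 3), (3, -2));
    ((6, -2), (6, -7), (3, 1)); ((6, -1), (12, -4), (3, 0));
    ((12, -1), (6, -5), (0, 2)); ((12, 0), (12, -2), (0, 1))]).
all: by rewrite /aval /=; ring.
Qed.

Lemma queens_12r10 (r : int) : 0 <= r ->
  has_queens (12 * r + 10) (12 * r + 10 - 1).
Proof.
move=> /board_queens; apply=> /=; first exact: (isT : valid 0 2 (12, 10) [::
    ((0, 0), (0, 0), (3, 1)); ((0, 1), (6, 7), (3, 0));
    ((6, 2), (6, -3), (3, 3)); ((6, 3), (12, 4), (3, 2));
    ((12, 7), (6, -1), (0, 2)); ((12, 8), (12, 6), (0, 1))]).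
all: by rewrite /aval /=; ring.
Qed.

Lemma queens_6r3 (r : int) : 2 <= r ->
  has_queens (6 * r + 3) (6 * r + 3 - 2).
Proof.
move=> /board_queens; apply=> /=; first exact: (isT : valid 2 1 (6, 3) [::
    ((0, 0), (0, 0), (1, -2)); ((1, -2), (2, -3), (2, 0));
    ((3, -1), (6, -2), (1, 1)); ((4, 1), (2, -2), (2, 0));
    ((6, 1), (6, -1), (0, 2))]).
all: by rewrite /aval /=; ring.
Qed.

Lemma queens_24r4 (r : int) : 1 <= r ->
  has_queens (24 * r + 4) (24 * r + 4 - 2).
Proof.
move=> /board_queens; apply=> /=; first exact: (isT : valid 1 2 (24, 4) [::
    ((0, 0), (12, 1), (0, 1)); ((0, 1), (12, 6), (6, 0));
    ((0, 2), (0, 4), (6, -1)); ((12, 0), (24, -1), (0, 1));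
    ((12, 1), (12, -3), (0, 1)); ((12, 2), (12, 2), (0, 1));
    ((12, 3), (24, 3), (6, 0)); ((12, 4), (12, 5), (6, -1))]).
all: by rewrite /aval /=; ring.
Qed.

Lemma queens_24r20 (r : int) : 0 <= r ->
  has_queens (24 * r + 20) (24 * r + 20 - 2).
Proof.
move=> /board_queens; apply=> /=; first exact: (isT : valid 0 2 (24, 20) [::
    ((0, 0), (12, 9), (0, 1)); ((0, 1), (12, 14), (6, 4));
    ((0, 2), (0, 4), (6, 3)); ((12, 8), (24, 15), (0, 1));
    ((12, 9), (12, 5), (0, 1)); ((12, 10), (12, 10), (0, 1));
    ((12, 11), (24, 19), (6, 4)); ((12, 12), (12, 13), (6, 3))]).
all: by rewrite /aval /=; ring.
Qed.

Lemma queens_24r8 (r : int) : 1 <= r ->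
  has_queens (24 * r + 8) (24 * r + 8 - 2).
Proof.
move=> /board_queens; apply=> /=; first exact: (isT : valid 1 2 (24, 8) [::
    ((0, 0), (12, 2), (0, 1)); ((0, 1), (0, 1), (0, 1));
    ((0, 2), (0, 4), (2, 0)); ((0, 3), (12, 7), (2, 0));
    ((4, 2), (20, 6), (0, 1)); ((4, 3), (8, 4), (2, 0));
    ((4, 4), (20, 11), (2, -1)); ((8, 3), (4, 3), (2, 0));
    ((8, 4), (16, 9), (2, 0)); ((12, 3), (0, 0), (0, 1));
    ((12, 4), (12, 3), (0, 1)); ((12, 5), (12, 6), (2, 0));
    ((12, 6), (0, 5), (2, 0)); ((16, 5), (20, 7), (0, 1));
    ((16, 6), (20, 10), (2, 0)); ((16, 7), (8, 5), (2, 0));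
    ((20, 7), (4, 2), (0, 1)); ((20, 8), (16, 5), (0, 1));
    ((20, 9), (16, 8), (2, 0)); ((20, 10), (4, 6), (2, -1))]).
all: by rewrite /aval /=; ring.
Qed.

Lemma queens_24r16 (r : int) : 0 <= r ->
  has_queens (24 * r + 16) (24 * r + 16 - 2).
Proof.
move=> /board_queens; apply=> /=; first exact: (isT : valid 0 2 (24, 16) [::
    ((0, 0), (0, 1), (0, 1)); ((0, 1), (12, 11), (0, 1));
    ((0, 2), (0, 4), (2, 1)); ((0, 3), (12, 14), (2, 0));
    ((4, 3), (8, 8), (0, 1)); ((4, 4), (20, 15), (0, 1));
    ((4, 5), (20, 18), (2, 2)); ((4, 6), (8, 13), (2, 0));
    ((8, 6), (16, 12), (0, 1)); ((8, 8), (4, 10), (2, 0));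
    ((8, 9), (16, 17), (2, 0)); ((12, 9), (0, 5), (2, 2));
    ((12, 10), (12, 15), (2, 0)); ((16, 10), (20, 14), (0, 1));
    ((16, 12), (8, 12), (2, 0)); ((16, 13), (20, 19), (2, 0));
    ((20, 12), (4, 3), (2, 2)); ((20, 13), (16, 13), (0, 1));
    ((20, 15), (16, 16), (2, 0))]).
all: by rewrite /aval /=; ring.
Qed.

Lemma queens_12r (r : int) : 3 <= r ->
  has_queens (12 * r) (12 * r - 2).
Proof.
move=> /board_queens; apply=> /=; first exact: (isT : valid 3 1 (12, 0) [::
    ((0, 0), (4, -1), (1, -3)); ((1, -3), (6, -6), (0, 1));
    ((1, -2), (12, -4), (2, -1)); ((3, -3), (10, -6), (0, 1));
    ((3, -2), (4, -5), (0, 1)); ((3, -1), (10, -3), (1, -2));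
    ((4, -2), (12, -5), (0, 1)); ((4, -1), (6, -4), (2, -1));
    ((6, -1), (4, -2), (1, -2)); ((7, -3), (12, -7), (0, 1));
    ((7, -2), (6, -5), (0, 1)); ((7, -1), (12, -3), (2, -1));
    ((9, -2), (10, -4), (1, -1)); ((10, -3), (6, -7), (0, 1));
    ((10, -2), (6, -3), (2, 0)); ((12, -2), (4, -6), (0, 1));
    ((12, -1), (4, -3), (0, 1))]).
all: by rewrite /aval /=; ring.
Qed.

Lemma queens_12r6 (r : int) : 3 <= r ->
  has_queens (12 * r + 6) (12 * r + 6 - 2).
Proof.
move=> /board_queens; apply=> /=; first exact: (isT : valid 3 2 (12, 6) [::
    ((0, 0), (12, 4), (0, 2)); ((0, 1), (0, 4), (0, 1));
    ((0, 3), (6, 5), (1, -1)); ((0, 4), (0, 8), (1, -3));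
    ((2, -2), (10, 1), (0, 1)); ((2, 0), (4, 0), (1, 2));
    ((2, 1), (4, 2), (0, 1)); ((2, 3), (10, 5), (1, 0));
    ((4, 3), (2, 1), (0, 1)); ((4, 4), (2, 5), (1, -1));
    ((4, 5), (8, 10), (1, -2)); ((6, 2), (12, 2), (0, 1));
    ((6, 3), (6, -1), (0, 1)); ((6, 4), (6, 3), (0, 1));
    ((6, 5), (6, 7), (0, 1)); ((6, 6), (6, 11), (1, -2));
    ((6, 7), (0, 6), (1, -1)); ((8, 2), (4, -4), (0, 1));
    ((8, 4), (10, 7), (1, -1)); ((8, 5), (10, 3), (0, 1));
    ((8, 7), (4, 6), (1, -2)); ((10, 2), (8, -2), (0, 1));
    ((10, 4), (2, -1), (0, 2)); ((10, 5), (8, 2), (0, 2));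
    ((10, 8), (8, 8), (1, -2)); ((10, 9), (2, 7), (1, -2));
    ((12, 4), (6, 1), (0, 1)); ((12, 5), (0, 0), (0, 1))]).
all: by rewrite /aval /=; ring.
Qed.

(** * Boards below the thresholds of the families *)

Lemma queens_3 : has_queens 3 1.
Proof.
by exists [::
    (0, 2)].
Qed.

Lemma queens_4 : has_queens 4 2.
Proof.
by exists [::
    (0, 0); (1, 2)].
Qed.

Lemma queens_6 : has_queens 6 4.
Proof.
by exists [::
    (0, 3); (1, 5); (2, 2); (3, 4)].
Qed.

Lemma queens_8 : has_queens 8 6.
Proof.
by exists [::
    (0, 3); (2, 2); (3, 7); (4, 1); (5, 4); (7, 0)].
Qed.

Lemma queens_9 : has_queens 9 7.
Proof.
by exists [::
    (0, 6); (1, 1); (2, 7); (3, 5); (4, 3); (5, 8); (6, 4)].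
Qed.

Lemma queens_12 : has_queens 12 10.
Proof.
by exists [::
    (0, 6); (1, 2); (2, 9); (3, 11); (4, 3); (5, 5); (7, 10); (8, 0); (9, 7);
    (11, 1)].
Qed.

Lemma queens_18 : has_queens 18 16.
Proof.
by exists [::
    (0, 2); (1, 13); (2, 16); (3, 7); (4, 5); (5, 0); (7, 10); (8, 14);
    (9, 6); (10, 9); (12, 1); (13, 3); (14, 12); (15, 15); (16, 8); (17, 4)].
Qed.

Lemma queens_24 : has_queens 24 22.
Proof.
by exists [::
    (0, 2); (1, 14); (2, 7); (3, 10); (4, 23); (5, 5); (6, 17); (7, 0);
    (8, 6); (9, 15); (10, 18); (11, 1); (12, 13); (13, 4); (14, 8); (17, 3);
    (18, 22); (19, 16); (20, 12); (21, 9); (22, 21); (23, 19)].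
Qed.

Lemma queens_30 : has_queens 30 28.
Proof.
by exists [::
    (0, 15); (1, 19); (2, 21); (3, 2); (4, 25); (5, 6); (6, 28); (7, 3);
    (8, 20); (9, 9); (10, 14); (11, 8); (12, 26); (13, 18); (14, 7);
    (15, 24); (16, 11); (17, 27); (18, 29); (19, 13); (20, 23); (21, 4);
    (22, 0); (24, 22); (25, 12); (26, 16); (28, 5); (29, 1)].
Qed.

(** * Placements for every board size *)

Lemma has_queens_le (M q q' : int) :
  0 <= q' <= q -> has_queens M q -> has_queens M q'.
Proof.
case: q' => // q' le_q [s sM sE]; exists (take q' s).
  move: sM; rewrite /peaceful -{1}(cat_take_drop q' s) pairwise_cat.
  by case/and3P.
by rewrite size_takel //; lia.
Qed.

(** Either [M] is prime to 6, and even [M] queens fit, or [M] is 2 or 10 modulo 12. *)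
Lemma queens_minus1 (M : nat) : (1 < M)%N -> ~~ (3 %| M)%N -> ~~ (4 %| M)%N ->
  has_queens M%:Z (M%:Z - 1).
Proof.
move=> M1 n3 n4.
have [r r0 E] : exists2 r : int, 0 <= r &
    [\/ M%:Z = 6 * r + 1, M%:Z = 6 * r + 5, M%:Z = 12 * r + 2
      | M%:Z = 12 * r + 10].
  have [|[|[|]]] : (M %% 6 = 1 \/ M %% 6 = 5 \/ M %% 12 = 2 \/ M %% 12 = 10)%N
    by lia.
  - by exists (M %/ 6)%N => //; constructor 1; lia.
  - by exists (M %/ 6)%N => //; constructor 2; lia.
  - by exists (M %/ 12)%N => //; constructor 3; lia.
  - by exists (M %/ 12)%N => //; constructor 4; lia.
case: E => ->.
- by apply: has_queens_le (queens_6r1 r0); lia.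
- by apply: has_queens_le (queens_6r5 r0); lia.
- have [r1|r1] := lerP 1 r; first exact: queens_12r2.
  suff -> : r = 0 by exists [:: (0, 0)]; rewrite ?mulr0.
    by lia.
- exact: queens_12r10.
Qed.

(** The cases follow the divisibility of [M] by 3 and by 4, then its residue modulo 24, 12 or 6. *)
Lemma queens_minus2 (M : nat) : (2 < M)%N -> has_queens M%:Z (M%:Z - 2).
Proof.
move=> M2.
have [n3|d3] := boolP (~~ (3 %| M)%N); have [n4|d4] := boolP (~~ (4 %| M)%N).
- by apply: has_queens_le (queens_minus1 _ n3 n4); lia.
- have [r r0 E] : exists2 r : int, 0 <= r &
      [\/ M%:Z = 24 * r + 4, M%:Z = 24 * r + 20, M%:Z = 24 * r + 8
        | M%:Z = 24 * r + 16].
    exists (M %/ 24)%N => //.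
    have [|[|[|]]] : (M %% 24 = 4 \/ M %% 24 = 20 \/ M %% 24 = 8 \/
      M %% 24 = 16)%N by lia.
    + by constructor 1; lia.
    + by constructor 2; lia.
    + by constructor 3; lia.
    + by constructor 4; lia.
  case: E => ->.
  + have [r1|r1] := lerP 1 r; first exact: queens_24r4.
    suff -> : r = 0 by exact: queens_4.
    by lia.
  + exact: queens_24r20.
  + have [r1|r1] := lerP 1 r; first exact: queens_24r8.
    suff -> : r = 0 by exact: queens_8.
    by lia.
  + exact: queens_24r16.
- have [r r0 [E|E]] : exists2 r : int, 0 <= r &
      M%:Z = 6 * r + 3 \/ M%:Z = 12 * r + 6.
    have [|] : (M %% 6 = 3 \/ M %% 12 = 6)%N by lia.
    + by exists (M %/ 6)%N => //; left; lia.
    + by exists (M %/ 12)%N => //; right; lia.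
  + rewrite E; have [r2|r2] := lerP 2 r; first exact: queens_6r3.
    have [->|->] : r = 0 \/ r = 1 by lia.
    * exact: queens_3.
    * exact: queens_9.
  + rewrite E; have [r3|r3] := lerP 3 r; first exact: queens_12r6.
    have [->|[->|->]] : r = 0 \/ r = 1 \/ r = 2 by lia.
    * exact: queens_6.
    * exact: queens_18.
    * exact: queens_30.
- have [r r0 E] : exists2 r : int, 0 < r & M%:Z = 12 * r.
    by exists (M %/ 12)%N; lia.
  rewrite E; have [r3|r3] := lerP 3 r; first exact: queens_12r.
  have [->|->] : r = 1 \/ r = 2 by lia.
  + exact: queens_12.
  + exact: queens_24.
Qed.

(** * Attacking queens, and runs determined by their starting points *)

Lemma attacksC (M : int) : symmetric (attacks M).
Proof.
move=> p q; apply: eq_has => f.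
by rewrite -[RHS]rpredN; congr (_ \in dvdz M); ring.
Qed.

Lemma attacksxx (M : int) : reflexive (attacks M).
Proof. by move=> p; apply/hasP; exists (1, 0) => //; rewrite !subrr. Qed.

Lemma peaceful_uniq (M : int) (s : seq (int * int)) : peaceful M s -> uniq s.
Proof. by apply: pairwise_uniq => p; rewrite attacksxx. Qed.

Lemma peaceful_eq (M : int) (s : seq (int * int)) (p q : int * int) :
  peaceful M s -> p \in s -> q \in s -> attacks M p q -> p = q.
Proof.
move=> /(pairwiseP (0, 0)) sP ps qs.
have ip : (index p s < size s)%N by rewrite index_mem.
have iq : (index q s < size s)%N by rewrite index_mem.
have [lt|lt|E _] := ltngtP (index p s) (index q s).
- by have /= := sP _ _ ip iq lt; rewrite !nth_index // => /negbTE->.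
- by have /= := sP _ _ iq ip lt; rewrite !nth_index // attacksC => /negbTE->.
- by rewrite -(nth_index (0, 0) ps) E nth_index.
Qed.

Lemma mulrn_pair (d : int * int) (i : nat) : d *+ i = (i%:Z * d.1, i%:Z * d.2).
Proof.
elim: i => [|i IH]; rewrite ?mulr0n ?mulrSr ?IH; congr (_, _); rewrite /=;
  lia.
Qed.

Lemma mem_run (p d q : int * int) (k : nat) :
  reflect (exists2 i, (i < k)%N & q = p + d *+ i) (q \in run p d k).
Proof.
apply: (iffP (imfsetP _ _ _ _)) => [[i] /=|[i ik ->]].
  by rewrite mem_iota => /= ik ->; exists i.
by exists i; rewrite //= mem_iota.
Qed.

(** Each starting point lies in the run of the other, at offsets whose sum times [d] vanishes; hence
    both offsets are 0. *)
Lemma run_inj (d : int * int) (k : nat) : (0 < k)%N -> d != 0 ->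
  injective (fun p => run p d k).
Proof.
move=> k0 d0 p q E.
have /mem_run[i _ pE] : p \in run q d k.
  by rewrite -E; apply/mem_run; exists 0%N; rewrite ?mulr0n ?addr0.
have /mem_run[j _ qE] : q \in run p d k.
  by rewrite E; apply/mem_run; exists 0%N; rewrite ?mulr0n ?addr0.
have : d *+ (i + j) = 0.
  by apply: (addrI q); rewrite addr0 mulrnDr addrA -pE -qE.
rewrite mulrn_pair; case=> /eqP + /eqP.
rewrite !mulf_eq0 => h1 h2; suff i0 : i = 0%N by rewrite pE i0 mulr0n addr0.
by move: d0 h1 h2; rewrite -pair_eqE /pair_eq /=; lia.
Qed.

(** * The perforated window and its number of points *)

Definition hole (M : int) (s : seq (int * int)) (z : int * int) : bool :=
  has (fun h => (M %| z.1 - h.1) && (M %| z.2 - h.2))%Z s.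

Definition window (L : nat) : seq (int * int) :=
  [seq (i%:Z, j%:Z) | i <- iota 0 L, j <- iota 0 L].

Lemma mem_window (L : nat) (z : int * int) :
  (z \in window L) = (0 <= z.1 < L%:Z) && (0 <= z.2 < L%:Z).
Proof.
apply/allpairsP/idP => [[[i j] /= []]|].
  by rewrite !mem_iota => hi hj ->; rewrite /=; lia.
case: z => x y /=; case/andP=> /andP[x0 xL] /andP[y0 yL].
exists (`|x|%N, `|y|%N) => /=; rewrite !mem_iota; split; try lia.
by congr (_, _); lia.
Qed.

Lemma window_uniq (L : nat) : uniq (window L).
Proof.
by apply: allpairs_uniq; rewrite ?iota_uniq // => -[a b] [c e] _ _ [-> ->].
Qed.

Lemma size_window (L : nat) : size (window L) = (L * L)%N.
Proof. by rewrite size_allpairs size_iota. Qed.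

Definition perforated (M : nat) (s : seq (int * int)) (N : nat) :
    {fset int * int} :=
  seq_fset tt [seq z <- window (M * N) | ~~ hole M s z].

Lemma mem_perforated (M : nat) (s : seq (int * int)) (N : nat) (z : int * int) :
  (z \in perforated M s N) = ~~ hole M s z && (z \in window (M * N)).
Proof. by rewrite seq_fsetE mem_filter. Qed.

(** The copy of the queen [h] in cell [c] of the tiling of the plane by [M x M] squares. *)
Definition shifted (M : int) (h c : int * int) : int * int :=
  ((h.1 %% M)%Z + M * c.1, (h.2 %% M)%Z + M * c.2).

Definition shifts (M : nat) (s : seq (int * int)) (cs : seq (int * int)) :
    seq (int * int) :=
  [seq shifted M h c | h <- s, c <- cs].

Lemma shifted_cong (M : int) (h c : int * int) :
  (M %| (shifted M h c).1 - h.1)%Z /\ (M %| (shifted M h c).2 - h.2)%Z.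
Proof.
split; rewrite /= addrAC rpredDr ?dvdz_mulr //.
  by rewrite -eqz_mod_dvd modz_mod.
by rewrite -eqz_mod_dvd modz_mod.
Qed.

Lemma hole_shifted (M : int) (s : seq (int * int)) (h c : int * int) :
  h \in s -> hole M s (shifted M h c).
Proof.
by move=> hs; apply/hasP; exists h => //; apply/andP; exact: shifted_cong.
Qed.

Lemma peaceful_cong (M : int) (s : seq (int * int)) (h h' : int * int) :
  peaceful M s -> h \in s -> h' \in s -> (M %| h.1 - h'.1)%Z -> h = h'.
Proof.
move=> sM hs hs' dv; apply: (peaceful_eq sM) => //.
by apply/hasP; exists (1, 0); rewrite //= mul1r mul0r addr0.
Qed.

(** Peaceful queens have distinct first coordinates modulo [M], so a copy determines its queen, and
    then its cell. *)
Lemma shifts_uniq (M : nat) (s cs : seq (int * int)) :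
  (0 < M)%N -> peaceful M s -> uniq cs -> uniq (shifts M s cs).
Proof.
move=> M0 sM cU; apply: allpairs_uniq => //; first exact: peaceful_uniq sM.
move=> _ _ /allpairsP[[h c] /= [hs _ ->]] /allpairsP[[h' c'] /= [hs' _ ->]] [].
move=> E1 E2; have Mn0 : M%:Z != 0 by lia.
have hh : h = h'.
  apply: (peaceful_cong sM) => //; rewrite -eqz_mod_dvd.
  move/(congr1 (fun z => z %% M)%Z): E1.
  by rewrite ![_ + M%:Z * _]addrC ![M%:Z * _]mulrC !modzMDl !modz_mod => ->.
move: E1 E2; rewrite hh => /addrI /(mulfI Mn0) E1 /addrI /(mulfI Mn0) E2.
by congr (_, _); case: c c' E1 E2 => [a b] [a' b'] /= -> ->.
Qed.

Lemma card_perforated (M N : nat) (s : seq (int * int)) :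
  (0 < M)%N -> peaceful M s ->
  (#|` perforated M s N| + size s * (N * N) <= M * N * (M * N))%N.
Proof.
move=> M0 sM; rewrite -[X in (_ <= X)%N]size_window.
rewrite -(count_predC (hole M s) (window _)) addnC.
apply: leq_add.
  (* Each queen has one copy in each of the [N * N] cells, which gives enough distinct holes. *)
  rewrite -(size_window N) -(size_allpairs (shifted M)) -size_filter.
  apply: uniq_leq_size; first by apply: shifts_uniq; rewrite // window_uniq.
  move=> _ /allpairsP[[h c] /= [hs cN ->]].
  rewrite mem_filter hole_shifted //= !mem_window /=.
  move: cN; rewrite mem_window => /andP[c1 c2].
  have MN (x c' : int) : 0 <= c' < N%:Z ->
      0 <= (x %% M)%Z + M%:Z * c' < (M * N)%:Z.
    move=> c0; have := modz_ge0 x (lt0r_neq0 (_ : 0 < M%:Z)).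
    have := ltz_pmod x (_ : 0 < M%:Z); nia.
  by rewrite !MN.
by rewrite /perforated size_seq_fset -size_filter size_undup.
Qed.

(** * Segments between consecutive holes *)

(** One of the [forms] vanishes on [d], so [h] and [h'] attack each other and must coincide. Then
    [M] divides [t], because [d] has a coordinate equal to 1. *)
Lemma line_peaceful (M t : int) (s : seq (int * int)) (h h' d : int * int) :
  peaceful M s -> h \in s -> h' \in s -> d \in directions -> 0 < t < M ->
  (M %| h.1 + t * d.1 - h'.1)%Z -> (M %| h.2 + t * d.2 - h'.2)%Z -> False.
Proof.
move=> sM hs hs' dP tM d1 d2.
have hh : h = h'.
  apply: (peaceful_eq sM) => //; apply/hasP.
  move: dP; rewrite !inE => /or4P[] /eqP dE;
    rewrite {}dE /= ?mulr0 ?mulr1 ?mulrN1 in d1 d2.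
  - by exists (0, 1); rewrite //= mul0r add0r mul1r; rewrite addr0 in d2.
  - by exists (1, 0); rewrite //= mul0r addr0 mul1r; rewrite addr0 in d1.
  - exists (-1, 1); rewrite //= mulN1r mul1r.
    by have := rpredB d2 d1; congr (_ \in dvdz M); ring.
  - exists (1, 1); rewrite //= !mul1r.
    by have := rpredD d2 d1; congr (_ \in dvdz M); ring.
have {d1 d2} : (M %| t)%Z.
  have E x : x + t - x = t by ring.
  move: dP; rewrite !inE => /or4P[] /eqP dE; move: d1 d2;
    by rewrite hh dE /= ?mulr0 ?mulr1 ?mulrN1 ?E.
case/dvdzP=> q E; have M0 : 0 < M by lia.
by move: tM; rewrite E pmulr_lgt0 // gtr_pMl //; lia.
Qed.

(** The outer ring of cells is a margin: a move of at most [M] from an inner cell stays in the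
    window. *)
Lemma shifted_window (x M d1 c n t : int) :
  0 < M -> 1 <= c <= n -> -1 <= d1 <= 1 -> 0 <= t <= M ->
  0 <= (x %% M)%Z + M * c + t * d1 < M * (n + 2).
Proof.
move=> M0 c1 d1P tM.
have r0 : 0 <= (x %% M)%Z by rewrite modz_ge0 // gt_eqF.
have rM : (x %% M)%Z < M by rewrite ltz_pmod.
have Mc : M * 1 <= M * c by rewrite ler_pM2l; lia.
have Mn : M * c <= M * n by rewrite ler_pM2l; lia.
have [-> | [-> | ->]] : d1 = -1 \/ d1 = 0 \/ d1 = 1 by lia.
all: rewrite ?mulrN1 ?mulr0 ?mulr1 mulrDr; lia.
Qed.

Definition inner (n : nat) : seq (int * int) :=
  [seq c + (1, 1) | c <- window n].

(** Each copy [z] of a queen in an inner cell yields the run from [z + d] to [z + k d]: both [z] and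
    [z + (k + 1) d] are holes, and there is none in between. *)
Lemma card_segments (k n : nat) (s : seq (int * int)) (d : int * int) :
  (0 < k)%N -> peaceful k.+1 s -> d \in directions ->
  (size s * (n * n) <= #|` segments (perforated k.+1 s n.+2) d k|)%N.
Proof.
move=> k0 sM dP; set P := perforated _ _ _.
have d0 : d != 0 by move: dP; rewrite !inE => /or4P[] /eqP->.
have [d1 d2] : (-1 <= d.1 <= 1) /\ (-1 <= d.2 <= 1).
  by move: dP; rewrite !inE => /or4P[] /eqP->.
have innerU : uniq (inner n).
  by rewrite map_inj_uniq ?window_uniq //; exact: addIr.
have <- : size (shifts k.+1 s (inner n)) = (size s * (n * n))%N.
  by rewrite size_allpairs size_map size_window.
rewrite -(undup_id (shifts_uniq _ sM innerU)) // -(size_seq_fset tt).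
pose F z := run (z + d) d k.
have F_inj : injective F.
  by move=> z z' /(run_inj k0 d0) /addIr.
set S := seq_fset tt _.
have <- : #|` [fset F z | z in S]%fset| = size S by rewrite card_imfset.
apply: fsubset_leq_card; apply/fsubsetP => _ /imfsetP[z /= + ->].
rewrite seq_fsetE => /allpairsP[[h c] /= [hs /mapP[c0 c0P cE] zE]].
have [zh1 zh2] : (k.+1%:Z %| z.1 - h.1)%Z /\ (k.+1%:Z %| z.2 - h.2)%Z.
  by rewrite zE; exact: shifted_cong.
have zd t : (t <= k.+1)%N -> z + d *+ t \in window (k.+1 * n.+2).
  move=> tk; rewrite mulrn_pair mem_window zE /= PoszM.
  have -> : (n.+2)%:Z = n%:Z + 2 by lia.
  move: c0P; rewrite mem_window cE => /andP[c1 c2].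
  by apply/andP; split; apply: shifted_window => //=; lia.
have zP t : (t < k)%N -> z + d *+ t.+1 \in P.
  move=> tk; rewrite mem_perforated zd ?ltnS ?(ltnW tk) // andbT.
  apply/hasPn => h' h's; apply/negP => /andP[].
  rewrite mulrn_pair /= => e1 e2.
  apply: (line_peaceful (t := t.+1%:Z) sM hs h's dP); first by lia.
  - by have := rpredB e1 zh1; congr (_ \in dvdz _); ring.
  - by have := rpredB e2 zh2; congr (_ \in dvdz _); ring.
have zH t : (k.+1 %| t)%N -> z + d *+ t \notin P.
  case/dvdnP=> q ->; rewrite mem_perforated negb_and negbK; apply/orP; left.
  apply/hasP; exists h => //.
  rewrite mulrn_pair /= PoszM -!mulrA ![q%:Z * _]mulrCA.
  by apply/andP; split; rewrite addrAC rpredDr // dvdz_mulr.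
apply/imfsetP; exists (z + d) => //=; rewrite !inE.
apply/andP; split; first by have := zP 0%N k0; rewrite mulr1n.
apply/and3P; split.
- apply/fsubsetP => q /mem_run[i ik ->].
  by rewrite -addrA -mulrS zP.
- by rewrite addrK; have := zH 0%N (dvdn0 _); rewrite mulr0n addr0.
- by rewrite -addrA -mulrS zH.
Qed.

Lemma num_perforated (k n : nat) (s : seq (int * int)) :
  (0 < k)%N -> peaceful k.+1 s ->
  (4 * (size s * (n * n)) <= num_segments (perforated k.+1 s n.+2) k)%N.
Proof.
move=> k0 sM; rewrite (_ : 4 * _ = \sum_(d <- directions) size s * (n * n))%N.
  by rewrite /num_segments !big_seq; apply: leq_sum => d; exact: card_segments.
by rewrite big_const_seq count_predT iter_addn_0 mulnC.
Qed.

(** * From the count to the limit *)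

(** The bounds on points and on segments combined, in additive form to avoid truncated
    subtraction. *)
Lemma min_points_le (k n : nat) (s : seq (int * int)) :
  (0 < k)%N -> peaceful k.+1 s ->
  (min_points k (4 * (size s * (n * n))) + size s * (n.+2 * n.+2) <=
   k.+1 * n.+2 * (k.+1 * n.+2))%N.
Proof.
move=> k0 sM; apply: leq_trans (card_perforated n.+2 (ltn0Sn k) sM).
rewrite leq_add2r.
have [_] := min_pointsP (4 * (size s * (n * n))) k0.
by apply; exact: num_perforated.
Qed.

Lemma point0 (R : realType) : point = 0 :> R. Proof. by []. Qed.
Lemma f_le_queens (R : realType) (k : nat) (s : seq (int * int)) :
  (0 < k)%N -> peaceful k.+1 s -> (0 < size s)%N ->
  f R k <= (k.+1%:R ^+ 2 - (size s)%:R) / (4 * (size s)%:R).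
Proof.
move=> k0 sM s0; set q := size s; set c := _ / _; rewrite /f.
have q0 : 0 < q%:R :> R by rewrite ltr0n.
have qM : (q <= k.+1 ^ 2)%N.
  (* For [n = 0] the count gives [4 q <= 4 (k + 1)^2]. *)
  by have := min_points_le 0 k0 sM; rewrite -/q; lia.
have K0 : 0 <= k.+1%:R ^+ 2 - q%:R :> R by rewrite subr_ge0 -natrX ler_nat.
have c0 : 0 <= c by rewrite divr_ge0 ?mulr_ge0 ?ler0n.
set u := fun n => _.
pose m n := (4 * (q * (n.+1 * n.+1)))%N.
(* With [x = n + 1], the window has [x + 2] cells a side, of which [x] are inner; the ratio is at
   most [c (x + 2)^2 / x^2], and [(x + 2)^2 <= x^2 + 8 x] as [x >= 1]. *)
have m_le n : u (m n) <= c + 8 * c * harmonic n.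
  have := min_points_le n.+1 k0 sM.
  rewrite -/q -(ler_nat R) natrD !natrM => le_m.
  have n0 : 0 < n.+1%:R :> R by rewrite ltr0n.
  rewrite /u /m /harmonic /= !natrM ler_pdivrMr ?mulr_gt0 //.
  have -> : (c + 8 * c * n.+1%:R^-1) * (4%:R * (q%:R * (n.+1%:R * n.+1%:R))) =
      (k.+1%:R ^+ 2 - q%:R) * (n.+1%:R ^+ 2 + 8 * n.+1%:R).
    by rewrite /c; field; rewrite !lt0r_neq0.
  have n1 : 1 <= n.+1%:R :> R by rewrite ler1n.
  have n3 : n.+3%:R = n.+1%:R + 2 :> R by rewrite -natrD addn2.
  apply: (@le_trans _ _ ((k.+1%:R ^+ 2 - q%:R) * n.+3%:R ^+ 2)).
    rewrite mulrBl lerBrDr; apply: (le_trans le_m).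
    by rewrite le_eqVlt; apply/orP; left; apply/eqP; ring.
  by rewrite ler_wpM2l // n3; nra.
(* [lim] is 0 if the sequence diverges. *)
have [cu|/dvgP ->] := pselect (cvgn u); last by rewrite point0.
(* A convergent [u] keeps its limit along the subsequence [m], so bounding it there suffices. *)
have mu : m @ \oo --> \oo.
  apply/cvgnyPge => A; near=> n; rewrite /m.
  have : (A <= n)%N by near: n; exact: nbhs_infty_ge.
  nia.
have := cvg_comp _ _ mu cu.
have : c + 8 * c * harmonic n @[n --> \oo] --> c + 8 * c * 0.
  by apply: cvgD; [exact: cvg_cst|apply: cvgMr; exact: cvg_harmonic].
rewrite mulr0 addr0 => cc cm.
by apply: (ler_cvg_to cm cc); near=> n; exact: m_le.
Unshelve. all: by end_near.
Qed.

Lemma f_le_has_queens (R : realType) (k q : nat) :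
  (0 < k)%N -> (0 < q)%N -> has_queens k.+1%:Z q%:Z ->
  f R k <= (k.+1%:R ^+ 2 - q%:R) / (4 * q%:R).
Proof.
by move=> k0 q0 [s sM [sq]]; rewrite -sq in q0 *; exact: f_le_queens.
Qed.

Theorem theorem4 (R : realType) :
  (forall k : nat, (2 <= k)%N ->
     f R k <= (k%:R * (k%:R + 1) + 2) / (4 * (k%:R - 1))) /\
  (forall k : nat, (1 <= k)%N -> ~~ (3 %| k.+1)%N -> ~~ (4 %| k.+1)%N ->
     f R k <= (k%:R * (k%:R + 1) + 1) / (4 * k%:R)).
Proof.
split=> [[//|k] k2|k k1 n3 n4].
  (* Here [k] is one less than the segment length: the board has side [k + 2] and carries [k]
     queens. *)
  have -> : (k.+1%:R * (k.+1%:R + 1) + 2) / (4 * (k.+1%:R - 1)) =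
      (k.+2%:R ^+ 2 - k%:R) / (4 * k%:R) :> R.
    by congr (_ / _); rewrite -!natr1; ring.
  apply: f_le_has_queens => //.
  by have := @queens_minus2 k.+2 k2; congr has_queens; lia.
(* Now [k] queens stand on a board of side [k + 1]. *)
have -> : (k%:R * (k%:R + 1) + 1) / (4 * k%:R) =
    (k.+1%:R ^+ 2 - k%:R) / (4 * k%:R) :> R.
  by congr (_ / _); rewrite -?natr1; ring.
apply: f_le_has_queens => //.
by have := @queens_minus1 k.+1 k1 n3 n4; congr has_queens; lia.
Qed.
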